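(* Let $G:\mathbb{H}\to\mathbb{R}$ be strongly convex and locally Lipschitz smooth with respect to the $\mathcal{L}$-norm. Then, for any $B\subset\mathbb{H}$ that is bounded and convex, there is $\hat L_B>0$ such that $$G(u)+\langle \delta G(u),v-u\rangle+\frac{1}{2\hat L_B}\|\delta G(v)-\delta G(u)\|_{\mathcal{L}^{-1}}^2\le G(v),\qquad \forall u,v\in B.$$ Consequently, $$\frac{1}{\hat L_B}\|\delta G(v)-\delta G(u)\|_{\mathcal{L}^{-1}}^2\le\langle\delta G(v)-\delta G(u),v-u\rangle,\qquad\forall u,v\in B.$$
   Context: $\mathbb{H}$ is a real separable Hilbert space with dual $\mathbb{H}^*$ and duality pairing $\langle\phi,v\rangle$ ($\phi\in\mathbb{H}^*$, $v\in\mathbb{H}$). All functionals $\mathbb{H}\to\mathbb{R}$ are assumed continuously Fréchet differentiable; $\delta G:\mathbb{H}\to\mathbb{H}^*$ denotes the Fréchet derivative of $G$. A preconditioner is a bounded linear map $\mathcal{L}:\mathbb{H}\to\mathbb{H}^*$ such that the bilinear form $(u,v)_{\mathcal{L}}:=\langle\mathcal{L}u,v\rangle$ is symmetric and there are $C_1,C_2>0$ with $(u,v)_{\mathcal{L}}\le C_2\|u\|_{\mathbb{H}}\|v\|_{\mathbb{H}}$ and $C_1\|u\|_{\mathbb{H}}^2\le(u,u)_{\mathcal{L}}$ for all $u,v\in\mathbb{H}$. A preconditioner $\mathcal{L}$ is fixed. Write $\|v\|_{\mathcal{L}}:=\sqrt{(v,v)_{\mathcal{L}}}$ for $v\in\mathbb{H}$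 and $\|\phi\|_{\mathcal{L}^{-1}}:=\sqrt{\langle\phi,\mathcal{L}^{-1}\phi\rangle}$ for $\phi\in\mathbb{H}^*$. $G$ is $\mu$-strongly convex with respect to the $\mathcal{L}$-norm if $\mu>0$ and $\langle\delta G(u)-\delta G(v),u-v\rangle\ge\mu\|u-v\|_{\mathcal{L}}^2$ for all $u,v\in\mathbb{H}$; $G$ is strongly convex if this holds for some $\mu>0$. $G$ is locally Lipschitz smooth with respect to the $\mathcal{L}$-norm if for every bounded convex $B\subset\mathbb{H}$ there is $L_B>0$ such that $\langle\delta G(u)-\delta G(v),u-v\rangle\le L_B\|u-v\|_{\mathcal{L}}^2$ for all $u,v\in B$; equivalently, $G(v)\le G(u)+\langle\delta G(u),v-u\rangle+\frac{L_B}{2}\|v-u\|_{\mathcal{L}}^2$ for all $u,v\in B$. *)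

(* Defs.v *)
From HB Require Import structures.
From mathcomp Require Import all_boot all_order all_algebra.
From mathcomp Require Import sesquilinear.
From mathcomp Require Import all_classical all_reals all_analysis.
Set Implicit Arguments.
Unset Strict Implicit.
Unset Printing Implicit Defensive.
Import Order.TTheory GRing.Theory Num.Theory.
Import numFieldNormedType.Exports.
Local Open Scope classical_set_scope.
Local Open Scope ring_scope.

Definition separable (T : topologicalType) :=
  exists2 S : set T, countable S & dense S.

(* A real Hilbert space is a complete normed space whose norm comes from an
   inner product [dot] (a symmetric positive definite bilinear form). *)
Definition hilbert_norm (R : realType) (H : completeNormedModType R)
    (dot : {dot H for idfun}) :=
  forall v : H, `|v| = Num.sqrt (dot v v).

Section Dual.
Context (R : realType) (H : normedModType R).

Definition dual_pred : {pred H -> R} :=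
  fun f => `[< linear (f : H -> R) /\ continuous (f : H -> R) >].

Lemma dual_pred_submod : submod_closed dual_pred.
Proof.
split.
  apply/asboolP; split; last by move=> x; exact: cvg_cst.
  by move=> a u v; rewrite -[LHS]/(0 : R) -[RHS]/(a *: (0 : R) + (0 : R)) scaler0 addr0.
move=> a f g /asboolP[lf cf] /asboolP[lg cg]; apply/asboolP; split.
  move=> b u v /=; rewrite !fctE lf lg !scalerDr !scalerA (mulrC a b).
  by rewrite addrACA.
move=> x; apply: cvgD; last exact: cg.
by apply: cvgZr; exact: cf.
Qed.

HB.instance Definition _ :=
  GRing.isSubmodClosed.Build R (H -> R) dual_pred dual_pred_submod.

Record dual : Type := Dual { dual_fun :> H -> R; _ : dual_fun \in dual_pred }.

HB.instance Definition _ := [isSub for dual_fun].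
HB.instance Definition _ := [Choice of dual by <:].
HB.instance Definition _ := [SubChoice_isSubLmodule of dual by <:].

Lemma dual_linear (phi : dual) : linear phi.
Proof. by have /asboolP[] := valP phi. Qed.

Lemma dual_continuous (phi : dual) : continuous phi.
Proof. by have /asboolP[] := valP phi. Qed.

HB.instance Definition _ (phi : dual) :=
  GRing.isLinear.Build R H R *:%R phi (dual_linear phi).

Definition opnorm (phi : dual) : R :=
  sup [set `|phi v| | v in [set v : H | `|v| <= 1]].

Lemma opnorm_has_sup (phi : dual) :
  has_sup [set `|phi v| | v in [set v : H | `|v| <= 1]].
Proof.
split; first by exists `|phi 0|; exists 0 => //=; rewrite normr0.
have /(_ phi)/iffLR := @linear_boundedP R H R.
have /(@continuous_linear_bounded R H R 0 phi) bphi :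
  {for 0, continuous phi} by exact: dual_continuous.
move=> /(_ bphi)/pinfty_ex_gt0[M M0 hM].
exists M => _ [v /= v1 <-]; apply: (le_trans (hM v)).
by rewrite ger_pMr.
Qed.

Lemma le_opnorm (phi : dual) (v : H) : `|phi v| <= opnorm phi * `|v|.
Proof.
have [->|v0] := eqVneq v 0; first by rewrite linear0 !normr0 mulr0.
have nv0 : 0 < `|v| by rewrite normr_gt0.
rewrite -ler_pdivrMr//; apply: sup_upper_bound; first exact: opnorm_has_sup.
exists (`|v|^-1 *: v) => /=.
  by rewrite normrZ gtr0_norm ?invr_gt0// mulVf ?gt_eqF.
by rewrite linearZ/= normrM gtr0_norm ?invr_gt0// mulrC.
Qed.

Lemma opnormD (phi psi : dual) : opnorm (phi + psi) <= opnorm phi + opnorm psi.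
Proof.
apply: ge_sup; first exact: (opnorm_has_sup _).1.
move=> _ [v /= v1 <-]; apply: (le_trans (ler_normD _ _)).
by apply: lerD; apply: sup_upper_bound (opnorm_has_sup _) _ _; exists v.
Qed.

Lemma opnormZ_le (a : R) (phi : dual) : opnorm (a *: phi) <= `|a| * opnorm phi.
Proof.
apply: ge_sup; first exact: (opnorm_has_sup _).1.
move=> _ [v /= v1 <-]; rewrite normrM ler_wpM2l//.
by apply: sup_upper_bound (opnorm_has_sup _) _ _; exists v.
Qed.

Lemma opnormZ (a : R) (phi : dual) : opnorm (a *: phi) = `|a| * opnorm phi.
Proof.
apply/eqP; rewrite eq_le opnormZ_le/=.
have [->|a0] := eqVneq a 0.
  rewrite normr0 mul0r; apply: (le_trans (normr_ge0 ((0 *: phi : dual) 0))).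
  apply: (sup_upper_bound (opnorm_has_sup _)).
  by exists 0 => //=; rewrite normr0.
rewrite -ler_pdivlMl ?normr_gt0// -normfV.
by apply: le_trans (opnormZ_le _ _); rewrite scalerA mulVf// scale1r.
Qed.

Lemma opnorm_eq0 (phi : dual) : opnorm phi = 0 -> phi = 0.
Proof.
move=> phi0; apply: val_inj; apply/funext => v /=.
by apply/eqP; rewrite -normr_le0 (le_trans (le_opnorm phi v))// phi0 mul0r.
Qed.

HB.instance Definition _ :=
  Lmodule_isNormed.Build R dual opnormD opnormZ opnorm_eq0.

Lemma dual_normE (phi : dual) : `|phi| = opnorm phi.
Proof. by []. Qed.

(* The Frechet derivative as an element of the dual; the default value 0 is
   only reached where G is not differentiable, see [frechetE]. *)
Definition frechet (G : H -> R) (u : H) : dual :=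
  insubd (0 : dual) ('d G u : H -> R).

Lemma frechetE (G : H -> R) (u v : H) :
  differentiable G u -> frechet G u v = 'd G u v.
Proof.
move=> dG; rewrite /frechet -[LHS]/(val _ v) insubdK//.
by apply/asboolP; split; [exact: linearP|exact: diff_continuous].
Qed.

Definition continuously_differentiable (G : H -> R) :=
  (forall u, differentiable G u) /\ continuous (frechet G).

Definition form_of (L : H -> dual) (u v : H) : R := L u v.

Record preconditioner (L : {linear H -> dual}) : Prop := {
  precond_bounded : exists C : R, forall u, `|L u| <= C * `|u|;
  precond_sym : forall u v, form_of L u v = form_of L v u;
  precond_upper :
    exists2 C2 : R, 0 < C2 & forall u v, form_of L u v <= C2 * `|u| * `|v|;
  precond_lower :
    exists2 C1 : R, 0 < C1 & forall u, C1 * `|u| ^+ 2 <= form_of L u u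
}.

Definition precond_norm (L : H -> dual) (v : H) : R :=
  Num.sqrt (form_of L v v).

(* A preconditioner on a complete space is bijective (Lax-Milgram), so that
   this is its inverse; the default value 0 is only reached off its range. *)
Definition precond_inv (L : H -> dual) : dual -> H :=
  'pinv_(fun=> 0) [set: H] L.

Definition precond_inv_norm (L : H -> dual) (phi : dual) : R :=
  Num.sqrt (phi (precond_inv L phi)).

Definition strongly_convex (L : H -> dual) (G : H -> R) :=
  exists2 mu : R, 0 < mu & forall u v,
    mu * precond_norm L (u - v) ^+ 2 <= (frechet G u - frechet G v) (u - v).

Definition locally_lipschitz_smooth (L : H -> dual) (G : H -> R) :=
  forall B : set H, bounded_set B -> convex_set B ->
  exists2 LB : R, 0 < LB & forall u v, B u -> B v ->
    (frechet G u - frechet G v) (u - v) <= LB * precond_norm L (u - v) ^+ 2.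

End Dual.

(* Main.v *)
Require Import Defs.
From mathcomp Require Import all_boot all_order all_algebra.
From mathcomp Require Import sesquilinear.
From mathcomp Require Import all_classical all_reals all_analysis.
From mathcomp Require Import ring lra.
Set Implicit Arguments.
Unset Strict Implicit.
Unset Printing Implicit Defensive.
Import Order.TTheory GRing.Theory Num.Theory.
Import numFieldNormedType.Exports.
Local Open Scope classical_set_scope.
Local Open Scope ring_scope.

(** The classical proof for a globally smooth convex function compares the
    value of G at w = v - s L^-1 p, where p = dG(v) - dG(u), with two bounds:
    w lies above the tangent of G at u (convexity), and below the quadratic
    tangent of G at v (smoothness).  Writing a = ||p||_(L^-1) and
      gap = G(v) - G(u) - <dG(u), v - u>,
    the comparison reads  s a^2 - l s^2 a^2 / 2 <= gap  for a smoothness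
    constant l ([gradient_step_gap]), and s = 1 / l gives the claim.

    Here smoothness is only local, so that l depends on a bounded set that
    must contain w, while the length s a of the step is not bounded a priori.
    The circularity is broken as follows.  With B in the ball of radius r, fix
    l on the ball of radius r + 1: every step with s a <= c is admissible, where
    c is a coercivity constant of the L-norm.  First the maximal step s = c / a
    is taken.  On the one hand the gap is bounded over B by some K, by
    smoothness; on the other hand that step makes it at least c a - l c^2 / 2.
    Hence a is bounded over B.  Once a is bounded, s = 1 / l' is admissible as
    soon as l' is large enough, and yields gap >= a^2 / (2 l').  This
    two-step argument about real numbers is [gap_lower_bound].  Adding
    the inequalities for (u, v) and (v, u) gives the second claim
    ([bregman_sum_cocoercive]).

    The tangent bounds come from the mean value theorem on segments
    ([tangent_below], [smooth_gap_upper]).  That L^-1 really is an inverse is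
    the symmetric case of the Lax-Milgram theorem ([precond_surjective]),
    obtained by minimizing the energy (v, v)_L - 2 <phi, v>. *)

(** * Evaluation of functionals *)

Lemma dualBE (R : realType) (H : normedModType R) (p q : dual H) (v : H) :
  (p - q) v = p v - q v.
Proof. by []. Qed.

Lemma dualZr (R : realType) (H : normedModType R) (p : dual H) (a : R) (v : H) :
  p (a *: v) = a * p v.
Proof. exact: linearZ. Qed.

Lemma dualDr (R : realType) (H : normedModType R) (p : dual H) (v w : H) :
  p (v + w) = p v + p w.
Proof. exact: linearD. Qed.

(** * Tangent bounds along segments *)

(** Subtracting the parabola with the prescribed slope leaves a function with
    nonpositive derivative, to which the mean value theorem applies. *)
Lemma slope_affine_upper (R : realType) (h h' : R -> R) (c : R) :
  (forall t, is_derive t (1 : R) h (h' t)) ->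
  (forall t, 0 < t -> t < 1 -> h' t - h' 0 <= c * t) ->
  h 1 <= h 0 + h' 0 + c / 2.
Proof.
move=> dh hc.
pose k t := h t - (h' 0 * t + c / 2 * t ^+ 2).
have dk t : is_derive t (1 : R) k (h' t - (h' 0 + c * t)).
  have dh't := dh t.
  rewrite /k; apply: is_derive_eq.
  by rewrite /GRing.scale /= /cst; field.
have kcont : {within `[0, 1], continuous k}.
  apply: continuous_subspaceT => x.
  by apply: differentiable_continuous; apply/derivable1_diffP; case: (dk x).
have [t /[!in_itv]/= /andP[t0 t1] e] := MVT ltr01 (fun t _ => dk t) kcont.
have := hc _ t0 t1; move: e; rewrite /k; lra.
Qed.

Lemma is_derive_line (R : realType) (H : normedModType R) (G : H -> R)
    (u d : H) (t : R) :
  differentiable G (u + t *: d) ->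
  is_derive t (1 : R) (fun s => G (u + s *: d)) (frechet G (u + t *: d) d).
Proof.
move=> dG; rewrite frechetE// -deriveE//.
(* both difference quotients are the same function of the increment *)
have E : (fun h : R => h^-1 *: (((fun s : R => G (u + s *: d)) \o shift t)
    (h *: 1) - G (u + t *: d))) =
  (fun h : R => h^-1 *: ((G \o shift (u + t *: d)) (h *: d)
    - G (u + t *: d))).
  apply/funext => h /=; congr (_ *: (G _ - _)).
  by rewrite [h *: 1]mulr1 scalerDl addrCA.
by apply: DeriveDef; rewrite /derivable /derive E//; exact: diff_derivable.
Qed.

Lemma tangent_above (R : realType) (H : normedModType R) (G : H -> R)
    (dG : forall x, differentiable G x) (u v : H) (c : R) :
  (forall t, 0 < t -> t < 1 ->
    (frechet G (u + t *: (v - u)) - frechet G u) (v - u) <= c * t) ->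
  G v <= G u + frechet G u (v - u) + c / 2.
Proof.
move=> hc; have dh t := is_derive_line (dG (u + t *: (v - u))).
have := slope_affine_upper dh (c := c).
rewrite !scale0r !scale1r !addr0 [u + (v - u)]addrC subrK; apply=> t t0 t1.
by have := hc _ t0 t1; rewrite dualBE.
Qed.

(** A monotone derivative makes G convex.  This is the bound
    [slope_affine_upper] for the opposite of G on the segment, with c = 0. *)
Lemma tangent_below (R : realType) (H : normedModType R) (G : H -> R)
    (dG : forall x, differentiable G x) :
  (forall u v, 0 <= (frechet G u - frechet G v) (u - v)) ->
  forall u v, G u + frechet G u (v - u) <= G v.
Proof.
move=> mono u v; have dh t := is_derive_line (dG (u + t *: (v - u))).
have dhN t : is_derive t (1 : R) (- (fun s => G (u + s *: (v - u))))
    (- frechet G (u + t *: (v - u)) (v - u)).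
  by have dht := dh t; apply: is_deriveN.
have := slope_affine_upper dhN (c := 0).
rewrite !fctE !scale0r !scale1r !addr0 [u + (v - u)]addrC subrK mul0r addr0.
rewrite -opprD lerN2; apply => t t0 t1.
have := mono (u + t *: (v - u)) u.
rewrite [u + _ - u]addrAC subrr add0r (dualZr (_ - _)) pmulr_rge0// dualBE.
by rewrite mul0r opprK subr_ge0 [X in _ -> X <= _]addrC subr_le0.
Qed.

Lemma convex_set_segment (R : realType) (H : normedModType R) (D : set H) :
  convex_set D -> forall u v t, D u -> D v -> 0 <= t <= 1 ->
  D (u + t *: (v - u)).
Proof.
move=> cD u v t Du Dv t01.
have := cD v u (Itv01 (andP t01).1 (andP t01).2).
rewrite !inE => /(_ Dv Du).
suff -> : conv (Itv01 (andP t01).1 (andP t01).2) (v : convex_lmodType H) u =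
  u + t *: (v - u) by [].
by rewrite /conv /= /unstable.onem scalerBr scalerBl scale1r addrCA.
Qed.

Lemma closed_ball_convex (R : realType) (H : normedModType R) (r : R) :
  convex_set [set x : H | `|x| <= r].
Proof.
move=> x y l; rewrite !inE/= => xr yr; rewrite /conv /= /unstable.onem.
apply: (le_trans (ler_normD _ _)); rewrite !normrZ.
have l0 : 0 <= l%:num by [].
have l1 : l%:num <= 1 by [].
rewrite !ger0_norm ?subr_ge0//.
have := @ler_wpM2l R _ l0 _ _ xr.
have l1' : 0 <= 1 - l%:num by rewrite subr_ge0.
have := @ler_wpM2l R _ l1' _ _ yr; lra.
Qed.

(** * The norm of a preconditioner *)

Section Preconditioner.
Context (R : realType) (H : normedModType R) (L : {linear H -> dual H}).
Hypothesis HL : preconditioner L.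

Lemma precondZE (a : R) (v w : H) : L (a *: v) w = a * L v w.
Proof. by rewrite linearZ. Qed.

Lemma precondDE (u v w : H) : L (u + v) w = L u w + L v w.
Proof. by rewrite linearD. Qed.

Lemma precondBE (u v w : H) : L (u - v) w = L u w - L v w.
Proof. by rewrite linearB. Qed.

Lemma form_ge0 (v : H) : 0 <= form_of L v v.
Proof.
have [C C0 hC] := precond_lower HL.
by apply: le_trans (hC v); rewrite mulr_ge0 ?exprn_ge0 ?(ltW C0).
Qed.

Lemma precond_norm_sqr (v : H) : precond_norm L v ^+ 2 = form_of L v v.
Proof. by rewrite sqr_sqrtr ?form_ge0. Qed.

Lemma precond_norm_ge :
  exists2 c : R, 0 < c & forall v, c * `|v| <= precond_norm L v.
Proof.
have [C C0 hC] := precond_lower HL.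
exists (Num.sqrt C); first by rewrite sqrtr_gt0.
move=> v; rewrite -(ler_pXn2r (ltn0Sn 1)) ?nnegrE ?mulr_ge0 ?sqrtr_ge0//.
by rewrite precond_norm_sqr exprMn sqr_sqrtr ?(ltW C0).
Qed.

Lemma precond_norm_le : exists2 c : R, 0 < c &
  forall v, precond_norm L v ^+ 2 <= c * `|v| ^+ 2.
Proof.
have [C C0 hC] := precond_upper HL; exists C => // v.
by rewrite precond_norm_sqr expr2 mulrA.
Qed.

Lemma precond_normZ_sqr (a : R) (v : H) :
  precond_norm L (a *: v) ^+ 2 = a ^+ 2 * precond_norm L v ^+ 2.
Proof.
by rewrite !precond_norm_sqr /form_of dualZr precondZE mulrA -expr2.
Qed.

(** * Invertibility of a preconditioner *)

(** The functional whose minimizer solves L v = phi. *)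
Definition energy (phi : dual H) (v : H) : R := form_of L v v - 2 * phi v.

(** The expansion of the energy in a direction w; the residual L v - phi is half
    its derivative at v. *)
Lemma energyD (phi : dual H) (v w : H) (t : R) :
  energy phi (v + t *: w) =
  energy phi v + 2 * t * (L v - phi) w + t ^+ 2 * precond_norm L w ^+ 2.
Proof.
rewrite precond_norm_sqr /energy /form_of dualBE.
rewrite !precondDE !dualDr !precondZE !dualZr.
have := precond_sym HL w v; rewrite /form_of => ->.
ring.
Qed.

Lemma energy_lbound (phi : dual H) : has_lbound (range (energy phi)).
Proof.
have [C C0 hC] := precond_lower HL.
exists (- (opnorm phi ^+ 2 / C)) => _ [v _ <-].
have h1 := hC v.
have h2 : phi v <= opnorm phi * `|v|.
  exact: le_trans (ler_norm _) (le_opnorm _ _).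
have h3 : 0 <= C * (`|v| - opnorm phi / C) ^+ 2.
  by rewrite mulr_ge0 ?sqr_ge0 ?(ltW C0).
(* completing the square in the norm of v *)
have h4 : C * (`|v| - opnorm phi / C) ^+ 2 =
  C * `|v| ^+ 2 - 2 * (opnorm phi * `|v|) + opnorm phi ^+ 2 / C.
  by field; rewrite gt_eqF.
rewrite /energy; lra.
Qed.

(** The discriminant bound, including the degenerate case y = 0 where the
    quadratic is affine in t. *)
Lemma quadratic_ge0_slope (x y e : R) : 0 <= y -> 0 <= e ->
  (forall t, 0 <= e ^+ 2 + 2 * t * x + t ^+ 2 * y ^+ 2) -> `|x| <= e * y.
Proof.
move=> y0 e0 h.
have [y_eq0|yn0] := eqVneq y 0.
  have [->|xn0] := eqVneq x 0; first by rewrite normr0 mulr_ge0.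
  (* the value of t at which the affine function equals -1 *)
  have := h (- ((e ^+ 2 + 1) / (2 * x))).
  have -> : 2 * - ((e ^+ 2 + 1) / (2 * x)) * x = - (e ^+ 2 + 1).
    by field.
  rewrite y_eq0 expr0n/= mulr0; lra.
rewrite -(ler_pXn2r (ltn0Sn 1)) ?nnegrE ?mulr_ge0//.
rewrite real_normK ?num_real//.
(* the value of t that minimizes the quadratic *)
have := h (- (x / y ^+ 2)).
have -> : e ^+ 2 + 2 * - (x / y ^+ 2) * x + (- (x / y ^+ 2)) ^+ 2 * y ^+ 2
   = ((e * y) ^+ 2 - x ^+ 2) / y ^+ 2 by field.
by rewrite pmulr_lge0 ?subr_ge0// invr_gt0 exprn_gt0// lt_neqAle eq_sym yn0.
Qed.

(** At an almost minimizer the residual is almost zero, since otherwise a step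
    in direction w would bring the energy below its infimum. *)
Lemma near_minimizer_residual (phi : dual H) (v w : H) (e : R) : 0 <= e ->
  energy phi v <= inf (range (energy phi)) + e ^+ 2 ->
  `|(L v - phi) w| <= e * precond_norm L w.
Proof.
move=> e0 hv; apply: quadratic_ge0_slope => // [|t]; first exact: sqrtr_ge0.
have : inf (range (energy phi)) <= energy phi (v + t *: w).
  by apply: ge_inf; [exact: energy_lbound|exists (v + t *: w)].
rewrite energyD; lra.
Qed.

(** Two approximate solutions of L v = phi are close to each other: their
    distance in the L-norm squared is the difference of their residuals
    evaluated at a - b.  So minimizing sequences are Cauchy. *)
Lemma precond_norm_residual (phi : dual H) (a b : H) (ea eb : R) :
  0 <= ea -> 0 <= eb ->
  (forall w, `|(L a - phi) w| <= ea * precond_norm L w) ->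
  (forall w, `|(L b - phi) w| <= eb * precond_norm L w) ->
  precond_norm L (a - b) <= ea + eb.
Proof.
move=> ea0 eb0 /(_ (a - b)) ha /(_ (a - b)) hb.
have [N0|N0] := lerP (precond_norm L (a - b)) 0.
  by apply: le_trans N0 _; rewrite addr_ge0.
rewrite -(ler_pM2r N0) -expr2 precond_norm_sqr /form_of mulrDl.
have -> : L (a - b) (a - b) = (L a - phi) (a - b) - (L b - phi) (a - b).
  by rewrite precondBE !dualBE opprB addrA subrK.
rewrite (le_trans (ler_norm _))// (le_trans (ler_normB _ _))//.
exact: lerD.
Qed.

End Preconditioner.

(** The theorem of Lax and Milgram for a symmetric form.  A minimizing sequence
    of the energy converges by completeness.  Its limit solves the equation
    because L v w = L w v is continuous in v for fixed w, while the residuals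
    tend to 0. *)
Lemma precond_surjective (R : realType) (H : completeNormedModType R)
    (L : {linear H -> dual H}) (HL : preconditioner L) (phi : dual H) :
  exists v, L v = phi.
Proof.
have [c c0 hc] := precond_norm_ge HL.
have /choice[x hx] n : exists v, energy L phi v <=
    inf (range (energy L phi)) + harmonic n ^+ 2 :> R.
  have [] := @inf_adherent _ (range (energy L phi)) (harmonic n ^+ 2).
  - by rewrite exprn_gt0 ?harmonic_gt0.
  - split; last exact: energy_lbound.
    by exists (energy L phi 0), 0.
  - by move=> _ [v _ <-] /ltW; exists v.
have res n w : `|(L (x n) - phi) w| <= harmonic n * precond_norm L w.
  exact: near_minimizer_residual (harmonic_ge0 _) (hx n).
have xcvg : cvgn x.
  apply/cauchy_cvgP/cauchy_exP => e e0.
  have [N _ hN] : \forall n \near \oo, (harmonic n : R) < c * e / 2.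
    have := @cvg_harmonic R; move/cvgr0_norm_lt => /(_ (c * e / 2)).
    rewrite divr_gt0 ?mulr_gt0// => /(_ isT); apply: filterS => n.
    by rewrite ger0_norm ?harmonic_ge0.
  exists (x N); exists N => // n /= Nn; rewrite -ball_normE/=.
  rewrite -(ltr_pM2l c0) (le_lt_trans (hc _))//.
  have h := precond_norm_residual HL (harmonic_ge0 N) (harmonic_ge0 n)
    (res N) (res n).
  apply: (le_lt_trans h); rewrite [ltRHS]splitr.
  by apply: ltrD; [exact: (hN N (leqnn N))|exact: (hN n Nn)].
exists (limn x); apply/val_inj/funext => w /=.
have lim1 : L (x n) w @[n --> \oo] --> L (limn x) w.
  have Lsym a : L a w = L w a by exact: (precond_sym HL).
  rewrite Lsym; under eq_fun do rewrite Lsym.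
  by apply: continuous_cvg; [exact: dual_continuous|].
have lim2 : L (x n) w @[n --> \oo] --> phi w.
  apply/subr_cvg0.
  apply: norm_cvg0.
  apply: (@squeeze_cvgr _ _ _ _ (cst 0)
    (fun n => harmonic n * precond_norm L w)).
  - by apply: nearW => n; rewrite normr_ge0/= -dualBE res.
  - exact: cvg_cst.
  - rewrite -[X in _ --> X](mul0r (precond_norm L w)).
    by apply: cvgMl; exact: cvg_harmonic.
exact: cvg_unique lim1 lim2.
Qed.

Lemma precond_invK (R : realType) (H : completeNormedModType R)
    (L : {linear H -> dual H}) (HL : preconditioner L) :
  cancel (precond_inv L) L.
Proof.
move=> phi; rewrite /precond_inv pinvK// inE.
by have [v <-] := precond_surjective HL phi; exists v.
Qed.

(** * The dual norm *)

Section InverseNorm.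
Context (R : realType) (H : completeNormedModType R) (L : {linear H -> dual H}).
Hypothesis HL : preconditioner L.

Lemma precond_inv_normE (phi : dual H) (d : H) : L d = phi ->
  precond_inv_norm L phi ^+ 2 = form_of L d d.
Proof.
move=> Ld; set e := precond_inv L phi.
have Le : L e = phi by exact: precond_invK.
have E : phi e = form_of L d d.
  by rewrite -Ld -[LHS]/(form_of L d e) (precond_sym HL) /form_of Le -Ld.
by rewrite sqr_sqrtr E ?form_ge0.
Qed.

Lemma precond_inv_normN (phi : dual H) :
  precond_inv_norm L (- phi) ^+ 2 = precond_inv_norm L phi ^+ 2.
Proof.
have Le := precond_invK HL phi.
rewrite (precond_inv_normE Le).
rewrite (@precond_inv_normE (- phi) (- precond_inv L phi)).
  rewrite -scaleN1r -!precond_norm_sqr// precond_normZ_sqr//.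
  by rewrite sqrrN expr1n mul1r.
by rewrite linearN/= Le.
Qed.
End InverseNorm.

(** * Inequalities from a gradient step *)

(** The self-improving estimate.  Here a stands for the dual norm of
    dG(v) - dG(u), D for the gap, K for an upper bound of the gap and s for the
    step size, subject to the bound c on the length of the step.
    The maximal step s = c / a bounds a by c M, where l' = l + M; this makes the
    step s = 1 / l' admissible, and since l <= l' that step gives the
    conclusion. *)
Lemma gap_lower_bound (R : realType) (l c K a D : R) :
  0 < l -> 0 < c -> 0 <= a -> D <= K ->
  (forall s, 0 <= s -> s * a <= c ->
    s * a ^+ 2 - l * s ^+ 2 * a ^+ 2 / 2 <= D) ->
  let l' := l + (K + l * c ^+ 2 / 2) / c ^+ 2 in
  (2 * l')^-1 * a ^+ 2 <= D.
Proof.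
move=> l0 c0 a0 DK h.
have D0 : 0 <= D.
  by have := h 0 (lexx 0); rewrite mul0r (ltW c0) => /(_ isT); lra.
pose M := (K + l * c ^+ 2 / 2) / c ^+ 2.
have M0 : 0 <= M.
  apply: divr_ge0; last exact: sqr_ge0.
  rewrite addr_ge0 ?(le_trans D0 DK)// divr_ge0//.
  by rewrite mulr_ge0 ?sqr_ge0 ?(ltW l0).
rewrite -/M /=; set l' := l + M.
have l'0 : 0 < l' by rewrite ltr_wpDr.
have aM : a <= c * M.
  have [->|an0] := eqVneq a 0; first by rewrite mulr_ge0 ?(ltW c0).
  have agt0 : 0 < a by rewrite lt_neqAle eq_sym an0.
  have := h (c / a); rewrite divr_ge0 ?(ltW c0)// divfK// lexx => /(_ isT isT).
  have -> : c / a * a ^+ 2 - l * (c / a) ^+ 2 * a ^+ 2 / 2 =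
    c * a - l * c ^+ 2 / 2.
    by field.
  have -> : c * M = (K + l * c ^+ 2 / 2) / c.
    by rewrite /M; field; rewrite gt_eqF.
  rewrite ler_pdivlMr//; lra.
have := h l'^-1; rewrite invr_ge0 (ltW l'0) => /(_ isT).
rewrite ler_pdivrMl// mulrC.
have -> : a <= c * l' by rewrite mulrDr ler_wpDl// mulr_ge0 ?(ltW c0) ?(ltW l0).
move=> /(_ isT); apply: le_trans.
have -> : (2 * l')^-1 * a ^+ 2 = a ^+ 2 / l' - l' * l'^-1 ^+ 2 * a ^+ 2 / 2.
  by field; rewrite gt_eqF.
(* one factor l' is kept in the quadratic term, to be compared with l *)
rewrite [l'^-1 * _]mulrC lerB// ler_pM2r//.
rewrite ler_wpM2r ?sqr_ge0// ler_wpM2r ?sqr_ge0//.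
by rewrite lerDl.
Qed.

Lemma smooth_gap_upper (R : realType) (H : normedModType R)
    (L : {linear H -> dual H}) (HL : preconditioner L) (G : H -> R)
    (dG : forall x, differentiable G x) (D : set H) (l : R) :
  convex_set D ->
  (forall u v, D u -> D v ->
    (frechet G u - frechet G v) (u - v) <= l * precond_norm L (u - v) ^+ 2) ->
  forall u v, D u -> D v ->
    G v <= G u + frechet G u (v - u) + l * precond_norm L (v - u) ^+ 2 / 2.
Proof.
move=> cD smooth u v Du Dv; apply: tangent_above => // t t0 t1.
rewrite -(ler_pM2l t0) -dualZr.
have := smooth (u + t *: (v - u)) u.
rewrite [u + _ - u]addrAC subrr add0r precond_normZ_sqr//.
have Dt : D (u + t *: (v - u)).
  by apply: convex_set_segment => //; rewrite !ltW.
move=> /(_ Dt Du) /le_trans; apply; lra.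
Qed.

(** The outcome of one step w of preconditioned gradient descent, started at v,
    for G - <dG(u), .>.  The functionals a and b stand for dG(u) and dG(v), and
    gu, gv, gw for the values of G at u, v, w. *)
Lemma gradient_step_gap (R : realType) (H : completeNormedModType R)
    (L : {linear H -> dual H}) (HL : preconditioner L) (a b : dual H)
    (u v w : H) (s l gu gv gw : R) :
  w = v - s *: precond_inv L (b - a) ->
  gu + a (w - u) <= gw ->
  gw <= gv + b (w - v) + l * precond_norm L (w - v) ^+ 2 / 2 ->
  s * precond_inv_norm L (b - a) ^+ 2
    - l * s ^+ 2 * precond_inv_norm L (b - a) ^+ 2 / 2
  <= gv - (gu + a (v - u)).
Proof.
move=> ->; have Ld := precond_invK HL (b - a).
rewrite (precond_inv_normE HL Ld).
move: (precond_inv L (b - a)) Ld => d Ld {w}.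
have -> : v - s *: d - v = (- s) *: d by rewrite addrAC subrr add0r scaleNr.
have -> : v - s *: d - u = (v - u) + (- s) *: d by rewrite scaleNr addrAC.
rewrite precond_normZ_sqr// sqrrN precond_norm_sqr// (dualZr b) (dualDr a).
rewrite (dualZr a) /form_of Ld dualBE.
move: (a _) (b _) (a _) => x y z; lra.
Qed.

(** The values of G cancel when the two inequalities are added. *)
Lemma bregman_sum_cocoercive (R : realType) (H : completeNormedModType R)
    (L : {linear H -> dual H}) (HL : preconditioner L) (a b : dual H)
    (u v : H) (k gu gv : R) :
  gu + a (v - u) + (2 * k)^-1 * precond_inv_norm L (b - a) ^+ 2 <= gv ->
  gv + b (u - v) + (2 * k)^-1 * precond_inv_norm L (a - b) ^+ 2 <= gu ->
  k^-1 * precond_inv_norm L (b - a) ^+ 2 <= (b - a) (v - u).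
Proof.
have -> : precond_inv_norm L (a - b) ^+ 2 = precond_inv_norm L (b - a) ^+ 2.
  by rewrite -precond_inv_normN// opprB.
have -> : b (u - v) = - b (v - u) by rewrite -mulN1r -dualZr scaleN1r opprB.
rewrite invfM dualBE; move: (a _) (b _) (precond_inv_norm _ _) => x y z; lra.
Qed.

(** * Cocoercivity on bounded sets *)

Theorem lemma2p6 (R : realType) (H : completeNormedModType R)
    (dot : {dot H for idfun}) (Hnorm : hilbert_norm dot) (Hsep : separable H)
    (L : {linear H -> dual H}) (HL : preconditioner L)
    (G : H -> R) (GC1 : continuously_differentiable G)
    (Gconvex : strongly_convex L G) (Gsmooth : locally_lipschitz_smooth L G) :
  forall B : set H, bounded_set B -> convex_set B ->
  exists LB : R, [/\ 0 < LB,
    forall u v, B u -> B v ->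
      G u + frechet G u (v - u)
        + (2 * LB)^-1 * precond_inv_norm L (frechet G v - frechet G u) ^+ 2
      <= G v &
    forall u v, B u -> B v ->
      LB^-1 * precond_inv_norm L (frechet G v - frechet G u) ^+ 2
      <= (frechet G v - frechet G u) (v - u)].
Proof.
move=> B bB cB.
have dG := GC1.1.
have [mu mu0 hmu] := Gconvex.
have mono u v : 0 <= (frechet G u - frechet G v) (u - v).
  by apply: le_trans (hmu u v); rewrite mulr_ge0 ?sqr_ge0 ?(ltW mu0).
have [r r0 Br] : exists2 r : R, 0 < r & forall x, B x -> `|x| <= r.
  by have [r r0 hr] := pinfty_ex_gt0 bB; exists r.
pose D := [set x : H | `|x| <= r + 1].
have cD : convex_set D by exact: closed_ball_convex.
have bD : bounded_set D.
  exists (r + 1); split=> [|M rM x /= /le_trans]; first exact: num_real.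
  by apply; exact: ltW.
have BD x : B x -> D x by move=> /Br /le_trans; apply; rewrite lerDl.
have [l l0 smooth] := Gsmooth D bD cD.
have upper := smooth_gap_upper HL dG cD smooth.
have [c c0 hc] := precond_norm_ge HL.
have [C C0 hC] := precond_norm_le HL.
(* K bounds the gap over B, since |v - u| <= 2 r there *)
pose K := l * (C * (2 * r) ^+ 2) / 2.
pose LB := l + (K + l * c ^+ 2 / 2) / c ^+ 2.
have K0 : 0 <= K.
  by rewrite /K divr_ge0// mulr_ge0 ?(ltW l0)// mulr_ge0 ?sqr_ge0 ?(ltW C0).
have LB0 : 0 < LB.
  rewrite ltr_wpDr// divr_ge0 ?sqr_ge0// addr_ge0// divr_ge0//.
  by rewrite mulr_ge0 ?sqr_ge0 ?(ltW l0).
have main u v : B u -> B v -> G u + frechet G u (v - u)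
    + (2 * LB)^-1 * precond_inv_norm L (frechet G v - frechet G u) ^+ 2 <= G v.
  move=> Bu Bv; rewrite addrC -lerBrDr.
  apply: gap_lower_bound => //; first exact: sqrtr_ge0.
    rewrite lerBlDl (le_trans (upper u v (BD _ Bu) (BD _ Bv)))// lerD2l.
    rewrite /K ler_pM2r// ler_pM2l// (le_trans (hC _))// ler_pM2l//.
    rewrite ler_pXn2r ?nnegrE ?mulr_ge0 ?(ltW r0)//.
    rewrite (le_trans (ler_normB _ _))// mulr_natl mulr2n lerD//; exact: Br.
  move=> s s0 sc; apply: (gradient_step_gap HL erefl).
    exact: tangent_below.
  (* the step stays in the ball D: its norm is at most s a / c <= 1 *)
  apply: upper; first exact: BD.
  rewrite /D/= (le_trans (ler_normB _ _))// lerD ?Br//.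
  rewrite normrZ ger0_norm// -(ler_pM2l c0) mulr1 mulrCA.
  apply: le_trans sc; rewrite ler_wpM2l//; apply: le_trans (hc _) _.
  rewrite -(ler_pXn2r (ltn0Sn 1)) ?nnegrE ?sqrtr_ge0//.
  by rewrite precond_norm_sqr// -(precond_inv_normE HL (precond_invK HL _)).
exists LB; split => // u v Bu Bv.
exact: bregman_sum_cocoercive (main u v Bu Bv) (main v u Bv Bu).
Qed.
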